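(* Let $(\mathcal{C},\otimes,I,\alpha,\lambda,\rho)$ be a monoidal category, and let $(M,m,e)$ be a monoid in $\mathcal{C}$, with $m:M\otimes M\to M$ and $e:I\to M$. If $M$ is an exponent, then $(M,m,e)$ is a sub-monoid of the monoid of endomorphisms $(M^M,c_M,i_M)$, as witnessed by the monic $\mathrm{rep}=\lfloor m\rfloor : M\to M^M$; that is, $\mathrm{rep}$ is a monomorphism in $\mathcal{C}$, $\mathrm{rep}\circ e=i_M$, and $\mathrm{rep}\circ m=c_M\circ(\mathrm{rep}\otimes\mathrm{rep})$. Moreover, $\mathrm{abs}\circ\mathrm{rep}=\mathrm{id}_M$, where $\mathrm{abs}:M^M\to M$ is the composite $$M^M\xrightarrow{\ \rho^{-1}_{M^M}\ }M^M\otimes I\xrightarrow{\ \mathrm{id}_{M^M}\otimes e\ }M^M\otimes M\xrightarrow{\ \mathrm{ev}_M\ }M.$$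
   Context: Structure isomorphisms: $\alpha_{A,B,C}:A\otimes(B\otimes C)\to(A\otimes B)\otimes C$, $\lambda_A:I\otimes A\to A$, $\rho_A:A\otimes I\to A$. A monoid in $\mathcal{C}$ is an object $M$ with morphisms $m:M\otimes M\to M$, $e:I\to M$ such that $m\circ(m\otimes\mathrm{id})\circ\alpha=m\circ(\mathrm{id}\otimes m)$, $m\circ(\mathrm{id}\otimes e)=\rho_M$ and $m\circ(e\otimes\mathrm{id})=\lambda_M$. An object $A$ of $\mathcal{C}$ is called an exponent if the functor $-\otimes A$ has a right adjoint $(-)^A$. The adjunction bijection $\mathcal{C}(X\otimes A,B)\cong\mathcal{C}(X,B^A)$, natural in $X$ and $B$, is written $f\mapsto\lfloor f\rfloor$, with inverse $g\mapsto\lceil g\rceil$; the evaluation morphism is the counit $\mathrm{ev}_B=\lceil\mathrm{id}_{B^A}\rceil:B^A\otimes A\to B$. For an exponent $A$, the monoid of endomorphisms on $A$ is $(A^A,c_A,i_A)$, with unit $i_A=\lfloor\lambda_A\rfloor:I\to A^A$ and multiplication $c_A:A^A\otimes A^A\to A^A$ given by $$c_A=\Big\lfloor (A^A\otimes A^A)\otimes A\xrightarrow{\alpha^{-1}}A^A\otimes(A^A\otimes A)\xrightarrow{\mathrm{id}\otimes\mathrm{ev}_A}A^A\otimes A\xrightarrow{\mathrm{ev}_A}A\Big\rfloor.$$ *)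

(* Defs.v *)
From mathcomp Require Import ssreflect ssrfun ssrbool.

Set Implicit Arguments.
Unset Strict Implicit.
Unset Printing Implicit Defensive.

Declare Scope cat_scope.
Delimit Scope cat_scope with cat.
Local Open Scope cat_scope.

Record category : Type := Category {
  ob :> Type;
  hom : ob -> ob -> Type;
  idm : forall A, hom A A;
  comp : forall A B C, hom B C -> hom A B -> hom A C;
  comp1m : forall A B (f : hom A B), comp (idm B) f = f;
  compm1 : forall A B (f : hom A B), comp f (idm A) = f;
  compA : forall A B C D (h : hom C D) (g : hom B C) (f : hom A B),
    comp h (comp g f) = comp (comp h g) f }.

Arguments hom {_} _ _.
Arguments idm {_} A.
Arguments comp {_ A B C} _ _.

Notation "g ∘ f" := (comp g f) (at level 45, left associativity) : cat_scope.

Definition monic (C : category) (A B : C) (f : hom A B) : Prop :=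
  forall (X : C) (g h : hom X A), f ∘ g = f ∘ h -> g = h.

Record functor (C D : category) : Type := Functor {
  fob :> C -> D;
  fmap : forall A B : C, hom A B -> hom (fob A) (fob B);
  fmap1 : forall A, fmap (idm A) = idm (fob A);
  fmapM : forall (A B E : C) (g : hom B E) (f : hom A B),
    fmap (g ∘ f) = fmap g ∘ fmap f }.

Arguments fmap {_ _} _ {A B} _.

Record adjunction (C D : category) (F : functor C D) (G : functor D C) : Type :=
  Adjunction {
  transpose : forall (X : C) (B : D), hom (F X) B -> hom X (G B);
  untranspose : forall (X : C) (B : D), hom X (G B) -> hom (F X) B;
  transposeK : forall X B (f : hom (F X) B), untranspose (transpose f) = f;
  untransposeK : forall X B (g : hom X (G B)), transpose (untranspose g) = g;
  transpose_natl : forall (X Y : C) (B : D) (f : hom (F X) B) (h : hom Y X),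
    transpose (f ∘ fmap F h) = transpose f ∘ h;
  transpose_natr : forall (X : C) (B B' : D) (f : hom (F X) B) (k : hom B B'),
    transpose (k ∘ f) = fmap G k ∘ transpose f }.

(* The associator is oriented as alpha : A (B C) -> (A B) C. *)
Record monoidal_category : Type := MonoidalCategory {
  moncat :> category;
  tens : moncat -> moncat -> moncat;
  tensm : forall A B A' B' : moncat,
    hom A A' -> hom B B' -> hom (tens A B) (tens A' B');
  unit_ob : moncat;
  alpha : forall A B C, hom (tens A (tens B C)) (tens (tens A B) C);
  alphaV : forall A B C, hom (tens (tens A B) C) (tens A (tens B C));
  lambda : forall A, hom (tens unit_ob A) A;
  lambdaV : forall A, hom A (tens unit_ob A);
  rho : forall A, hom (tens A unit_ob) A;
  rhoV : forall A, hom A (tens A unit_ob);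
  tensm1 : forall A B, tensm (idm A) (idm B) = idm (tens A B);
  tensmM : forall A B A' B' A'' B''
      (f' : hom A' A'') (g' : hom B' B'') (f : hom A A') (g : hom B B'),
    tensm (f' ∘ f) (g' ∘ g) = tensm f' g' ∘ tensm f g;
  alphaK : forall A B C, alphaV A B C ∘ alpha A B C = idm _;
  alphaVK : forall A B C, alpha A B C ∘ alphaV A B C = idm _;
  lambdaK : forall A, lambdaV A ∘ lambda A = idm _;
  lambdaVK : forall A, lambda A ∘ lambdaV A = idm _;
  rhoK : forall A, rhoV A ∘ rho A = idm _;
  rhoVK : forall A, rho A ∘ rhoV A = idm _;
  alpha_nat : forall A B C A' B' C'
      (f : hom A A') (g : hom B B') (h : hom C C'),
    alpha A' B' C' ∘ tensm f (tensm g h) = tensm (tensm f g) h ∘ alpha A B C;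
  lambda_nat : forall A A' (f : hom A A'),
    lambda A' ∘ tensm (idm unit_ob) f = f ∘ lambda A;
  rho_nat : forall A A' (f : hom A A'),
    rho A' ∘ tensm f (idm unit_ob) = f ∘ rho A;
  pentagon : forall A B C D,
    alpha (tens A B) C D ∘ alpha A B (tens C D) =
    tensm (alpha A B C) (idm D) ∘ alpha A (tens B C) D
      ∘ tensm (idm A) (alpha B C D);
  triangle : forall A B,
    tensm (rho A) (idm B) ∘ alpha A unit_ob B = tensm (idm A) (lambda B) }.

Arguments tens {_} A B.
Arguments tensm {_ A B A' B'} _ _.
Arguments unit_ob {_}.
Arguments alpha {_} A B C.
Arguments alphaV {_} A B C.
Arguments lambda {_} A.
Arguments lambdaV {_} A.
Arguments rho {_} A.
Arguments rhoV {_} A.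

Notation "A ⊗ B" := (tens A B) (at level 40, left associativity) : cat_scope.
Notation "f ⊠ g" := (tensm f g) (at level 40, left associativity) : cat_scope.
Notation "'𝟙'" := unit_ob : cat_scope.

Record monoid (C : monoidal_category) : Type := Monoid {
  mon_ob :> C;
  mon_mul : hom (mon_ob ⊗ mon_ob) mon_ob;
  mon_unit : hom 𝟙 mon_ob;
  mon_mulA : mon_mul ∘ (mon_mul ⊠ idm mon_ob) ∘ alpha mon_ob mon_ob mon_ob =
    mon_mul ∘ (idm mon_ob ⊠ mon_mul);
  mon_mul1 : mon_mul ∘ (idm mon_ob ⊠ mon_unit) = rho mon_ob;
  mon_1mul : mon_mul ∘ (mon_unit ⊠ idm mon_ob) = lambda mon_ob }.

Arguments mon_mul {C} m.
Arguments mon_unit {C} m.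

Definition is_submonoid (C : monoidal_category) (M N : monoid C)
    (f : hom M N) : Prop :=
  [/\ monic f,
      f ∘ mon_unit M = mon_unit N
    & f ∘ mon_mul M = mon_mul N ∘ (f ⊠ f)].

Section TensorRight.
Variables (C : monoidal_category) (A : C).

Lemma tensor_right1 (X : C) : idm X ⊠ idm A = idm (X ⊗ A).
Proof. exact: tensm1. Qed.

Lemma tensor_rightM (X Y Z : C) (g : hom Y Z) (f : hom X Y) :
  (g ∘ f) ⊠ idm A = (g ⊠ idm A) ∘ (f ⊠ idm A).
Proof. by rewrite -tensmM comp1m. Qed.

Definition tensor_right : functor C C :=
  @Functor C C (fun X => X ⊗ A) (fun X Y f => f ⊠ idm A)
    tensor_right1 tensor_rightM.

End TensorRight.

Record exponent (C : monoidal_category) (A : C) : Type := Exponent {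
  exp_functor : functor C C;
  exp_adj : adjunction (tensor_right A) exp_functor }.

Section Exponent.
Variables (C : monoidal_category) (A : C) (E : exponent A).

Definition expo (B : C) : C := exp_functor E B.

Definition curry (X B : C) (f : hom (X ⊗ A) B) : hom X (expo B) :=
  @transpose _ _ _ _ (exp_adj E) X B f.

Definition uncurry (X B : C) (g : hom X (expo B)) : hom (X ⊗ A) B :=
  @untranspose _ _ _ _ (exp_adj E) X B g.

Definition ev (B : C) : hom (expo B ⊗ A) B := uncurry (idm (expo B)).

Definition endo_unit : hom 𝟙 (expo A) := curry (lambda A).

Definition endo_mul : hom (expo A ⊗ expo A) (expo A) :=
  curry (ev A ∘ (idm (expo A) ⊠ ev A) ∘ alphaV (expo A) (expo A) A).

End Exponent.

Section MonoidalTheory.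
Variable C : monoidal_category.

Lemma alphaV_nat (A B D A' B' D' : C)
    (f : hom A A') (g : hom B B') (h : hom D D') :
  alphaV A' B' D' ∘ ((f ⊠ g) ⊠ h) = (f ⊠ (g ⊠ h)) ∘ alphaV A B D.
Proof.
by rewrite -[LHS]compm1 -(alphaVK A B D) compA -(compA (alphaV _ _ _))
  -alpha_nat !compA alphaK comp1m.
Qed.

Lemma tensm_inj1 (A B : C) (f g : hom A B) :
  idm 𝟙 ⊠ f = idm 𝟙 ⊠ g -> f = g.
Proof.
move=> fg; rewrite -[f]compm1 -[g]compm1 -(lambdaVK A) !compA.
by rewrite -!lambda_nat fg.
Qed.

(* Kelly's coherence identity, the left-unit analogue of the triangle. *)
Lemma lambda_alpha (A B : C) :
  (lambda A ⊠ idm B) ∘ alpha 𝟙 A B = lambda (A ⊗ B).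
Proof.
apply: tensm_inj1; rewrite -[idm 𝟙 in LHS]compm1 tensmM.
have := congr1 (comp ((rho 𝟙 ⊠ idm A) ⊠ idm B)) (pentagon 𝟙 𝟙 A B).
rewrite !compA -tensmM comp1m triangle -!alpha_nat tensm1 -compA triangle.
rewrite -compA => /(congr1 (comp (alphaV _ _ _))).
by rewrite !compA alphaK !comp1m.
Qed.

Lemma pentagonV (A B D E : C) :
  alphaV A B (D ⊗ E) ∘ alphaV (A ⊗ B) D E ∘ (alpha A B D ⊠ idm E) =
  (idm A ⊠ alphaV B D E) ∘ alphaV A (B ⊗ D) E.
Proof.
have H : (alpha A B D ⊠ idm E) =
   alpha (A ⊗ B) D E ∘ alpha A B (D ⊗ E) ∘ (idm A ⊠ alphaV B D E)
     ∘ alphaV A (B ⊗ D) E.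
  rewrite pentagon -!compA (compA (idm A ⊠ _)) -tensmM alphaVK comp1m tensm1.
  by rewrite comp1m alphaVK compm1.
by rewrite H !compA -(compA (alphaV A B _)) alphaK compm1 alphaK comp1m.
Qed.

Variables (A : C) (E : exponent A).

Lemma curryK (X B : C) (f : hom (X ⊗ A) B) : uncurry (curry E f) = f.
Proof. exact: (@transposeK _ _ _ _ (exp_adj E)). Qed.

Lemma uncurryK (X B : C) (g : hom X (expo E B)) : curry E (uncurry g) = g.
Proof. exact: untransposeK. Qed.

Lemma uncurry_inj (X B : C) (f g : hom X (expo E B)) :
  uncurry f = uncurry g -> f = g.
Proof. by move=> fg; rewrite -[f]uncurryK fg uncurryK. Qed.

Lemma uncurry_comp (X Y B : C) (f : hom X (expo E B)) (h : hom Y X) :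
  uncurry (f ∘ h) = uncurry f ∘ (h ⊠ idm A).
Proof.
rewrite -[f in LHS]uncurryK /curry -transpose_natl.
exact: (@transposeK _ _ _ _ (exp_adj E)).
Qed.

Lemma uncurryE (X B : C) (f : hom X (expo E B)) :
  uncurry f = ev E B ∘ (f ⊠ idm A).
Proof. by rewrite -uncurry_comp comp1m. Qed.

Lemma ev_curry (X B : C) (f : hom (X ⊗ A) B) :
  ev E B ∘ (curry E f ⊠ idm A) = f.
Proof. by rewrite -uncurryE curryK. Qed.

Lemma uncurry_endo_mul (X Y : C) (f : hom X (expo E A)) (g : hom Y (expo E A)) :
  uncurry (endo_mul E ∘ (f ⊠ g)) =
  uncurry f ∘ (idm X ⊠ uncurry g) ∘ alphaV X Y A.
Proof.
rewrite uncurry_comp curryK -compA alphaV_nat compA; congr (_ ∘ _).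
rewrite -compA -tensmM comp1m -uncurryE (uncurryE f) -compA -tensmM.
by rewrite compm1 comp1m.
Qed.

Lemma endo_mulA :
  endo_mul E ∘ (endo_mul E ⊠ idm (expo E A))
    ∘ alpha (expo E A) (expo E A) (expo E A) =
  endo_mul E ∘ (idm (expo E A) ⊠ endo_mul E).
Proof.
apply: uncurry_inj; rewrite uncurry_comp !uncurry_endo_mul curryK.
rewrite -/(ev E A).
rewrite -(compA (_ ∘ _) (alphaV _ _ A) (idm _ ⊠ ev E A)) -tensm1 alphaV_nat.
rewrite -!compA (compA (alphaV _ _ _) (alphaV _ _ _)) pentagonV.
rewrite (compA (idm _ ⊠ ev E A) (idm _ ⊠ _)) -tensmM comp1m.
by rewrite (compA (idm _ ⊠ _) (idm _ ⊠ _)) -tensmM comp1m !compA.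
Qed.

Lemma endo_mul1 :
  endo_mul E ∘ (idm (expo E A) ⊠ endo_unit E) = rho (expo E A).
Proof.
apply: uncurry_inj; rewrite uncurry_endo_mul curryK (uncurryE (rho _)).
by rewrite -triangle -!compA alphaVK compm1.
Qed.

Lemma endo_1mul :
  endo_mul E ∘ (endo_unit E ⊠ idm (expo E A)) = lambda (expo E A).
Proof.
apply: uncurry_inj; rewrite uncurry_endo_mul curryK (uncurryE (lambda _)).
by rewrite lambda_nat -lambda_alpha -!compA alphaVK compm1.
Qed.

Definition endo_monoid : monoid C := Monoid endo_mulA endo_mul1 endo_1mul.

End MonoidalTheory.

Section Representation.
Variables (C : monoidal_category) (M : monoid C) (E : exponent M).

Definition rep : hom M (endo_monoid E) := curry E (mon_mul M).

Definition abs : hom (endo_monoid E) M :=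
  ev E M ∘ (idm (expo E M) ⊠ mon_unit M) ∘ rhoV (expo E M).

End Representation.

Arguments rep {C M} E.
Arguments abs {C M} E.

(* Main.v *)
From mathcomp Require Import ssreflect ssrfun ssrbool.
Require Import Defs.
Local Open Scope cat_scope.

(** Cayley's argument: [rep] sends x to left multiplication by x and [abs] evaluates at the unit, so
    [abs_rep] is the right unit law x·e = x, and [rep], being split, is monic. Currying is
    bijective, so the homomorphism laws may be checked uncurried, where they become the left unit
    law and associativity of [M]. *)

Lemma rhoV_nat (C : monoidal_category) (A B : C) (f : hom A B) :
  rhoV B ∘ f = (f ⊠ idm 𝟙) ∘ rhoV A.
Proof.
by rewrite -[f in LHS]compm1 -(rhoVK A) (compA f) -rho_nat !compA rhoK comp1m.
Qed.

Lemma split_monic (C : category) (A B : C) (r : hom B A) (s : hom A B) :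
  r ∘ s = idm A -> monic s.
Proof. by move=> rs X g h /(congr1 (comp r)); rewrite !compA rs !comp1m. Qed.

Section Representation.
Variables (C : monoidal_category) (M : monoid C) (E : exponent M).

Lemma abs_rep : abs E ∘ rep E = idm (mon_ob M).
Proof.
rewrite /abs -(compA _ (rhoV _)) rhoV_nat (compA _ (rep E ⊠ _)).
rewrite -(compA (ev E M)) -tensmM comp1m compm1.
(* Factor [rep E ⊠ mon_unit M] so that [rep] meets [ev], which cancels the currying. *)
rewrite -[rep E]compm1 -[mon_unit M]comp1m tensmM compA.
by rewrite ev_curry mon_mul1 rhoVK.
Qed.

Lemma rep_unit : rep E ∘ mon_unit M = mon_unit (endo_monoid E).
Proof.
by apply: (uncurry_inj (E := E)); rewrite uncurry_comp !curryK mon_1mul.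
Qed.

Lemma rep_mul :
  rep E ∘ mon_mul M = mon_mul (endo_monoid E) ∘ (rep E ⊠ rep E).
Proof.
(* Uncurried, the sides are [m ∘ (m ⊠ id)] and [m ∘ (id ⊠ m) ∘ alphaV], with m the product of
   [M]. *)
apply: (uncurry_inj (E := E)); rewrite uncurry_endo_mul uncurry_comp !curryK.
by rewrite -mon_mulA -!compA alphaVK compm1.
Qed.

End Representation.

Theorem theorem2p10 (C : monoidal_category) (M : monoid C) (E : exponent M) :
  is_submonoid (rep E) /\ abs E ∘ rep E = idm (mon_ob M).
Proof.
split; last exact: abs_rep.
by split; [exact: split_monic (abs_rep _ _ E) | exact: rep_unit | exact: rep_mul].
Qed.
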